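(* The unit speed space-like curve $g:I\to\mathbb{H}^2$ is a part of a pseudo-circle if and only if the corresponding time-like Bertrand curve $$\tilde\gamma(v)=a\int_0^v g(t)\,dt+a\tanh\xi_2\int_0^v g(t)\times g'(t)\,dt$$ is a helix, where $a$ and $\xi_2=\xi_2(u)=\coth\theta\,\ln u$ are constants and $\theta$ is a constant different from $0$.
   Context: Minkowski 3-space $\mathbb{R}^3_1$ is $\mathbb{R}^3$ with $\langle x,y\rangle=x_1y_1+x_2y_2-x_3y_3$ and $\|x\|=\sqrt{|\langle x,x\rangle|}$. A vector $x$ is space-like if $\langle x,x\rangle>0$ or $x=0$, time-like if $\langle x,x\rangle<0$, light-like if $\langle x,x\rangle=0$ and $x\neq0$. A regular curve defined on an interval $I\subset\mathbb{R}$ is space-like (time-like) if all its velocity vectors are; it is unit speed if its velocity has pseudo-norm $1$. The Lorentzian cross product is $x\times y=(x_2y_3-x_3y_2,\;x_3y_1-x_1y_3,\;x_2y_1-x_1y_2)$, so that $\langle x\times y,z\rangle=\det(x,y,z)$. Hyperbolic space is $\mathbb{H}^2=\{x\in\mathbb{R}^3_1:\langle x,x\rangle=-1\}$. For $u_0\in\mathbb{H}^2$ and $r\in\mathbb{R}$, the pseudo-circle with center $u_0$ on $\mathbb{H}^2$ is $PS^1(u_0,r)=\{w\in\mathbb{H}^2:\langle w,u_0\rangle=r\}$. For a time-like curve $\alpha$ with arc-length parameter $s$, the Frenet frame is $T=\alpha'$, $N=\alpha''/\|\alpha''\|$, $B=T\times N$; the curvature is $\kappa=\|T'\|$ and the torsion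 is $\tau=\langle N',B\rangle$. A time-like curve is a (time-like) Bertrand curve if and only if there are non-zero real constants $A,B$ such that $A\kappa(s)+B\tau(s)=1$ for all $s$. A helix is a curve which makes a constant angle with a fixed direction; if a time-like curve is a helix then $\tau/\kappa$ is constant, and conversely a time-like curve with non-light-like normal vector and $\tau/\kappa$ constant is a helix.
   Formalization: ''Helix'' is taken as constant hyperbolic angle with a fixed time-like direction; with arbitrary directions (τ/κ constant) the claim fails, e.g. for the geodesic g(v)=(sinh v,0,cosh v), whose curve is a helix with space-like axis but which lies on no pseudo-circle centred in H². *)

(* Defs.v *)
From Stdlib Require Import Reals.
From Coquelicot Require Import Coquelicot.
Local Open Scope R_scope.

Record vec3 : Type := Vec3 { x1 : R; x2 : R; x3 : R }.

Definition vzero : vec3 := Vec3 0 0 0.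

Definition vadd (x y : vec3) : vec3 :=
  Vec3 (x1 x + x1 y) (x2 x + x2 y) (x3 x + x3 y).

Definition vscale (c : R) (x : vec3) : vec3 :=
  Vec3 (c * x1 x) (c * x2 x) (c * x3 x).

Definition mdot (x y : vec3) : R :=
  x1 x * x1 y + x2 x * x2 y - x3 x * x3 y.

Definition mnorm (x : vec3) : R := sqrt (Rabs (mdot x x)).

(* The sign of the third coordinate is the one for which
   mdot (mcross x y) z = det (x, y, z). *)
Definition mcross (x y : vec3) : vec3 :=
  Vec3 (x2 x * x3 y - x3 x * x2 y)
       (x3 x * x1 y - x1 x * x3 y)
       (x2 x * x1 y - x1 x * x2 y).

Definition space_like (x : vec3) : Prop := 0 < mdot x x \/ x = vzero.
Definition time_like (x : vec3) : Prop := mdot x x < 0.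

(* Both sheets, as in the equation <x, x> = -1. *)
Definition in_H2 (x : vec3) : Prop := mdot x x = -1.

Definition pseudo_circle (u0 : vec3) (r : R) (w : vec3) : Prop :=
  in_H2 w /\ mdot w u0 = r.

(* Any non-degenerate interval: open, closed, half-open, possibly unbounded. *)
Definition is_interval (I : R -> Prop) : Prop :=
  (exists a b, I a /\ I b /\ a < b) /\
  (forall a b t, I a -> I b -> a <= t <= b -> I t).

(* A curve on I is a total function of which only the values on I matter,
   except that smoothness is required on an open neighbourhood of I: at an
   endpoint belonging to I the two-sided derivatives below then agree with the
   one-sided ones. *)
Definition smooth_on (I : R -> Prop) (c : R -> vec3) : Prop :=
  forall t, I t -> locally t (fun s => forall n,
    ex_derive_n (fun y => x1 (c y)) n s /\
    ex_derive_n (fun y => x2 (c y)) n s /\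
    ex_derive_n (fun y => x3 (c y)) n s).

Definition vderive (c : R -> vec3) (t : R) : vec3 :=
  Vec3 (Derive (fun y => x1 (c y)) t)
       (Derive (fun y => x2 (c y)) t)
       (Derive (fun y => x3 (c y)) t).

Definition vint (c : R -> vec3) (a b : R) : vec3 :=
  Vec3 (RInt (fun y => x1 (c y)) a b)
       (RInt (fun y => x2 (c y)) a b)
       (RInt (fun y => x3 (c y)) a b).

Definition unit_speed_space_like (I : R -> Prop) (c : R -> vec3) : Prop :=
  smooth_on I c /\
  forall t, I t -> space_like (vderive c t) /\ mnorm (vderive c t) = 1.

Definition time_like_curve (I : R -> Prop) (c : R -> vec3) : Prop :=
  smooth_on I c /\ forall t, I t -> time_like (vderive c t).

Definition part_of_pseudo_circle (I : R -> Prop) (c : R -> vec3) : Prop :=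
  exists (u0 : vec3) (r : R),
    in_H2 u0 /\ forall t, I t -> pseudo_circle u0 r (c t).

(* The derivative of X with respect to the arc length s of c, for an arbitrary
   regular parameter t: d/ds = (1 / |c'(t)|) d/dt. *)
Definition arc_derive (c X : R -> vec3) (t : R) : vec3 :=
  vscale (/ mnorm (vderive c t)) (vderive X t).

Definition tangent (c : R -> vec3) : R -> vec3 := arc_derive c c.

Definition curvature (c : R -> vec3) (t : R) : R :=
  mnorm (arc_derive c (tangent c) t).

Definition normal (c : R -> vec3) (t : R) : vec3 :=
  vscale (/ curvature c t) (arc_derive c (tangent c) t).

Definition binormal (c : R -> vec3) (t : R) : vec3 :=
  mcross (tangent c t) (normal c t).

Definition torsion (c : R -> vec3) (t : R) : R :=
  mdot (arc_derive c (normal c) t) (binormal c t).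

(* Non-vanishing curvature is what makes the Frenet frame exist. *)
Definition time_like_Bertrand (I : R -> Prop) (c : R -> vec3) : Prop :=
  time_like_curve I c /\
  (forall t, I t -> curvature c t <> 0) /\
  exists A B : R, A <> 0 /\ B <> 0 /\
    forall t, I t -> A * curvature c t + B * torsion c t = 1.

(* phi is the hyperbolic angle between time-like vectors of the same time
   cone; the negative sign of mdot x y forces the cones to agree. *)
Definition hyperbolic_angle (x y : vec3) (phi : R) : Prop :=
  time_like x /\ time_like y /\ 0 <= phi /\
  mdot x y = - (mnorm x * mnorm y * cosh phi).

(* A direction is a line R d, so d may be replaced by - d to lie in the cone of
   the tangents.  The angle with a time-like tangent is the hyperbolic angle,
   so the direction is time-like. *)
Definition time_like_helix (I : R -> Prop) (c : R -> vec3) : Prop :=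
  time_like_curve I c /\
  exists (d : vec3) (phi : R),
    forall t, I t -> hyperbolic_angle (tangent c t) d phi.

Definition coth (x : R) : R := cosh x / sinh x.

Definition xi2 (theta u : R) : R := coth theta * ln u.

Definition bertrand_curve (g : R -> vec3) (a xi : R) (v : R) : vec3 :=
  vadd (vscale a (vint g 0 v))
       (vscale (a * tanh xi)
          (vint (fun t => mcross (g t) (vderive g t)) 0 v)).

(* Main.v *)
Require Import Defs.
From Stdlib Require Import Reals Lra.
From Coquelicot Require Import Coquelicot.
Local Open Scope R_scope.

(** Write [s = g x g'] and let [T] be the unit tangent of the Bertrand curve.
    Its velocity is [a (g + tanh xi s)], whose square is constant because
    [g, g', s] is an orthonormal frame; hence [T = k (g + tanh xi s)] with a
    nonzero constant [k] ([tangent_bertrand]).  Since [s' = g x g''] is a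
    multiple of [g'] ([is_vderive_s]), the derivative of [T] is a multiple of
    [g'] as well, and the factor does not vanish because the curvature does
    not ([is_vderive_W_nonzero]).  So for every fixed vector [d] the derivatives
    of [<g, d>] and [<T, d>] are nonzero multiples of each other, and one
    product is constant exactly when the other is ([mdot_g_constant_iff]).

    Constancy of [<g, d>] for some [d] in the hyperbolic plane is the
    pseudo-circle condition.  Constancy of [<T, d>] for such a [d] is the helix
    condition: by the reversed Cauchy-Schwarz inequality the constant is plus
    or minus a hyperbolic cosine ([constant_hyperbolic_angle]).

    The interval may contain its endpoints, where derivatives are two-sided
    while the geometric identities hold on one side only.  This is harmless:
    differentiable functions that agree on a non-degenerate interval have equal
    derivatives on all of it ([is_derive_eq_on]). *)

(** * Lorentzian algebra *)

Lemma vec3_eq (x y : vec3) :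
  x1 x = x1 y -> x2 x = x2 y -> x3 x = x3 y -> x = y.
Proof. destruct x, y; simpl; intros; subst; reflexivity. Qed.

Lemma mdot_comm (x y : vec3) : mdot x y = mdot y x.
Proof. unfold mdot; ring. Qed.

Lemma mdot_scale_l (c : R) (x y : vec3) : mdot (vscale c x) y = c * mdot x y.
Proof. unfold mdot, vscale; simpl; ring. Qed.

Lemma mdot_scale_r (c : R) (x y : vec3) : mdot x (vscale c y) = c * mdot x y.
Proof. unfold mdot, vscale; simpl; ring. Qed.

Lemma mdot_add_self (x y : vec3) :
  mdot (vadd x y) (vadd x y) = mdot x x + 2 * mdot x y + mdot y y.
Proof. unfold mdot, vadd; simpl; ring. Qed.

Lemma mdot_cross_l (x y : vec3) : mdot x (mcross x y) = 0.
Proof. unfold mdot, mcross; simpl; ring. Qed.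

(** The Lagrange identity has the sign opposite to the Euclidean one. *)
Lemma mdot_cross_self (x y : vec3) :
  mdot (mcross x y) (mcross x y) = mdot x y * mdot x y - mdot x x * mdot y y.
Proof. unfold mdot, mcross; simpl; ring. Qed.

Lemma mcross_mcross (x y z : vec3) :
  mcross (mcross x y) z
  = vadd (vscale (mdot y z) x) (vscale (- mdot x z) y).
Proof. apply vec3_eq; unfold mdot, mcross, vadd, vscale; simpl; ring. Qed.

(** Both factors lie in the plane orthogonal to [t], so their product is
    normal to that plane; the double product formula, used twice, makes
    this explicit. *)
Lemma mcross_of_orthogonal (p q t : vec3) :
  mdot p t = 0 -> mdot q t = 0 -> mdot t t = 1 ->
  mcross p q = vscale (mdot (mcross p q) t) t.
Proof.
  intros hp hq ht.
  pose proof (mcross_mcross p q t) as h1.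
  pose proof (mcross_mcross (mcross p q) t t) as h2.
  rewrite h1, hp, hq, ht in h2.
  set (m := mcross p q) in *.
  pose proof (f_equal x1 h2) as e1.
  pose proof (f_equal x2 h2) as e2.
  pose proof (f_equal x3 h2) as e3.
  unfold mcross, vadd, vscale in e1, e2, e3; simpl in e1, e2, e3.
  apply vec3_eq; unfold vscale; simpl; lra.
Qed.

Lemma time_like_orthogonal (x z : vec3) :
  time_like x -> mdot x z = 0 -> 0 <= mdot z z.
Proof.
  unfold time_like, mdot; destruct x as [a b c], z as [p q r]; simpl.
  intros hx hz.
  assert (hc : 0 < c * c) by nra.
  (* Euclidean Cauchy-Schwarz for the space components *)
  assert (cs : (c * r) * (c * r) <= (a * a + b * b) * (p * p + q * q)).
  { replace (c * r) with (a * p + b * q) by lra.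
    pose proof (Rle_0_sqr (a * q - b * p)); unfold Rsqr in *; nra. }
  assert (0 <= p * p + q * q) by nra.
  apply Rmult_le_reg_l with (c * c); [exact hc | nra].
Qed.

(** Reversed Cauchy-Schwarz: [mcross x y] is orthogonal to the time-like
    [x], hence its square in the Lagrange identity is nonnegative. *)
Lemma reversed_cauchy_schwarz (x y : vec3) :
  in_H2 x -> in_H2 y -> 1 <= mdot x y * mdot x y.
Proof.
  unfold in_H2; intros hx hy.
  assert (h : 0 <= mdot (mcross x y) (mcross x y)).
  { apply time_like_orthogonal with x.
    - unfold time_like; lra.
    - apply mdot_cross_l. }
  rewrite mdot_cross_self, hx, hy in h; lra.
Qed.

Lemma mnorm_time_like (x : vec3) : time_like x -> mnorm x = sqrt (- mdot x x).
Proof. intro h; unfold mnorm; rewrite Rabs_left by exact h; reflexivity. Qed.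

Lemma mnorm_time_like_sqr (x : vec3) :
  time_like x -> mnorm x * mnorm x = - mdot x x.
Proof.
  intro h; rewrite mnorm_time_like by exact h.
  apply sqrt_sqrt; unfold time_like in h; lra.
Qed.

Lemma mnorm_time_like_pos (x : vec3) : time_like x -> 0 < mnorm x.
Proof.
  intro h; rewrite mnorm_time_like by exact h.
  apply sqrt_lt_R0; unfold time_like in h; lra.
Qed.

Lemma normalized_in_H2 (x : vec3) :
  time_like x -> in_H2 (vscale (/ mnorm x) x).
Proof.
  intro h; unfold in_H2; rewrite mdot_scale_l, mdot_scale_r.
  pose proof (mnorm_time_like_pos x h); pose proof (mnorm_time_like_sqr x h).
  replace (mdot x x) with (- (mnorm x * mnorm x)) by lra.
  field; lra.
Qed.

Lemma in_H2_time_like (x : vec3) : in_H2 x -> time_like x.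
Proof. unfold in_H2, time_like; lra. Qed.

Lemma mnorm_in_H2 (x : vec3) : in_H2 x -> mnorm x = 1.
Proof.
  intro h; rewrite mnorm_time_like by (now apply in_H2_time_like).
  rewrite h; replace (- -1) with 1 by ring; apply sqrt_1.
Qed.

Lemma in_H2_opp (x : vec3) : in_H2 x -> in_H2 (vscale (-1) x).
Proof. unfold in_H2; rewrite mdot_scale_l, mdot_scale_r; lra. Qed.

Lemma space_like_unit (x : vec3) : space_like x -> mnorm x = 1 -> mdot x x = 1.
Proof.
  intros h hn; unfold mnorm in hn.
  assert (h1 : Rabs (mdot x x) = 1).
  { rewrite <- (sqrt_sqrt (Rabs (mdot x x))) by apply Rabs_pos.
    rewrite hn; ring. }
  destruct h as [h | ->].
  - rewrite Rabs_right in h1; lra.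
  - unfold mdot, vzero in *; simpl in *.
    replace (0 * 0 + 0 * 0 - 0 * 0) with 0 in h1 by ring.
    rewrite Rabs_R0 in h1; lra.
Qed.

Lemma cosh_surj (c : R) : 1 <= c -> exists phi, 0 <= phi /\ cosh phi = c.
Proof.
  intro hc.
  exists (arcsinh (sqrt (c * c - 1))).
  set (s := sqrt (c * c - 1)).
  assert (hs : s * s = c * c - 1) by (apply sqrt_sqrt; nra).
  split.
  - rewrite <- arcsinh_0; apply arcsinh_le, sqrt_pos.
  - assert (hp : 0 < cosh (arcsinh s)).
    { pose proof (exp_pos (arcsinh s)); pose proof (exp_pos (- arcsinh s)).
      unfold cosh; lra. }
    pose proof (sinh_arcsinh s) as hsh.
    assert (h2 : cosh (arcsinh s) * cosh (arcsinh s) - s * s = 1).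
    { rewrite <- hsh at 3 4.
      unfold cosh, sinh.
      assert (exp (arcsinh s) * exp (- arcsinh s) = 1).
      { rewrite <- exp_plus, Rplus_opp_r; apply exp_0. }
      nra. }
    nra.
Qed.

(** A common hyperbolic angle with a time-like line is the same as a constant
    product with a unit vector of that line.  The reversed Cauchy-Schwarz
    inequality makes the constant at least [1] in absolute value, so it is
    plus or minus a hyperbolic cosine, and the sign is absorbed by the choice
    of one of the two unit vectors. *)
Lemma constant_hyperbolic_angle (I : R -> Prop) (T : R -> vec3) (t0 : R) :
  I t0 -> (forall t, I t -> in_H2 (T t)) ->
  (exists d phi, forall t, I t -> hyperbolic_angle (T t) d phi) <->
  (exists u0 c, in_H2 u0 /\ forall t, I t -> mdot (T t) u0 = c).
Proof.
  intros ht0 hT; split.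
  - intros (d & phi & h).
    assert (hd : time_like d) by (destruct (h t0 ht0) as (_ & hd & _); exact hd).
    exists (vscale (/ mnorm d) d), (- cosh phi); split.
    { now apply normalized_in_H2. }
    intros t ht; destruct (h t ht) as (_ & _ & _ & e).
    rewrite mdot_scale_r, e, (mnorm_in_H2 (T t)) by now apply hT.
    pose proof (mnorm_time_like_pos d hd); field; lra.
  - intros (u0 & c & hu0 & h).
    assert (hc : 1 <= c * c).
    { rewrite <- (h t0 ht0).
      apply reversed_cauchy_schwarz; auto. }
    (* the vector of the line in the time cone of the tangents *)
    assert (build : forall d e, in_H2 d -> 1 <= e ->
      (forall t, I t -> mdot (T t) d = - e) ->
      exists d' phi, forall t, I t -> hyperbolic_angle (T t) d' phi).
    { intros d e hd he hde.
      destruct (cosh_surj e he) as (phi & hphi & ephi).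
      exists d, phi; intros t ht.
      repeat split; [now apply in_H2_time_like, hT | now apply in_H2_time_like
        | exact hphi |].
      rewrite (mnorm_in_H2 (T t)), (mnorm_in_H2 d), ephi, hde; auto; ring. }
    destruct (Rle_lt_dec c 0) as [hn | hp].
    + apply (build u0 (- c)); [exact hu0 | nra |].
      intros t ht; rewrite h by exact ht; ring.
    + apply (build (vscale (-1) u0) c); [now apply in_H2_opp | nra |].
      intros t ht; rewrite mdot_scale_r, h by exact ht; ring.
Qed.

(** * Derivatives of curves, and functions known on an interval only *)

Definition is_vderive (c : R -> vec3) (t : R) (l : vec3) : Prop :=
  is_derive (fun y => x1 (c y)) t (x1 l) /\
  is_derive (fun y => x2 (c y)) t (x2 l) /\
  is_derive (fun y => x3 (c y)) t (x3 l).

Lemma is_vderive_unique (c : R -> vec3) (t : R) (l : vec3) :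
  is_vderive c t l -> vderive c t = l.
Proof.
  intros (h1 & h2 & h3).
  apply vec3_eq; unfold vderive; simpl; now apply is_derive_unique.
Qed.

Lemma is_derive_plus_R (f h : R -> R) (t df dh : R) :
  is_derive f t df -> is_derive h t dh ->
  is_derive (fun y => f y + h y) t (df + dh).
Proof. exact (is_derive_plus f h t df dh). Qed.

Lemma is_derive_minus_R (f h : R -> R) (t df dh : R) :
  is_derive f t df -> is_derive h t dh ->
  is_derive (fun y => f y - h y) t (df - dh).
Proof. exact (is_derive_minus f h t df dh). Qed.

Lemma is_derive_mult_R (f h : R -> R) (t df dh : R) :
  is_derive f t df -> is_derive h t dh ->
  is_derive (fun y => f y * h y) t (df * h t + f t * dh).
Proof.
  intros hf hh.
  apply (is_derive_mult f h t df dh hf hh); intros; apply Rmult_comm.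
Qed.

Lemma is_vderive_add (c e : R -> vec3) (t : R) (dc de : vec3) :
  is_vderive c t dc -> is_vderive e t de ->
  is_vderive (fun y => vadd (c y) (e y)) t (vadd dc de).
Proof.
  intros (h1 & h2 & h3) (k1 & k2 & k3).
  split; [| split]; simpl; now apply is_derive_plus_R.
Qed.

Lemma is_vderive_scale (f : R -> R) (c : R -> vec3) (t df : R) (dc : vec3) :
  is_derive f t df -> is_vderive c t dc ->
  is_vderive (fun y => vscale (f y) (c y)) t
    (vadd (vscale df (c t)) (vscale (f t) dc)).
Proof.
  intros hf (h1 & h2 & h3).
  split; [| split]; simpl; now apply is_derive_mult_R.
Qed.

Lemma is_vderive_scale_const (k : R) (c : R -> vec3) (t : R) (dc : vec3) :
  is_vderive c t dc -> is_vderive (fun y => vscale k (c y)) t (vscale k dc).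
Proof.
  intros (h1 & h2 & h3).
  split; [| split]; simpl; now apply is_derive_scal.
Qed.

Lemma is_derive_mdot (c e : R -> vec3) (t : R) (dc de : vec3) :
  is_vderive c t dc -> is_vderive e t de ->
  is_derive (fun y => mdot (c y) (e y)) t (mdot dc (e t) + mdot (c t) de).
Proof.
  intros (h1 & h2 & h3) (k1 & k2 & k3); unfold mdot.
  replace (_ + _) with
    ((x1 dc * x1 (e t) + x1 (c t) * x1 de)
     + (x2 dc * x2 (e t) + x2 (c t) * x2 de)
     - (x3 dc * x3 (e t) + x3 (c t) * x3 de)) by ring.
  apply is_derive_minus_R; [apply is_derive_plus_R |]; now apply is_derive_mult_R.
Qed.

Lemma is_vderive_const (d : vec3) (t : R) : is_vderive (fun _ => d) t vzero.
Proof.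
  split; [| split]; apply (is_derive_const (K := R_AbsRing) (V := R_NormedModule)).
Qed.

Lemma is_derive_mdot_const (c : R -> vec3) (d : vec3) (t : R) (dc : vec3) :
  is_vderive c t dc -> is_derive (fun y => mdot (c y) d) t (mdot dc d).
Proof.
  intro h.
  replace (mdot dc d) with (mdot dc d + mdot (c t) vzero)
    by (unfold mdot, vzero; simpl; ring).
  apply (is_derive_mdot c (fun _ => d)); [exact h | apply is_vderive_const].
Qed.

Lemma is_vderive_mcross (c e : R -> vec3) (t : R) (dc de : vec3) :
  is_vderive c t dc -> is_vderive e t de ->
  is_vderive (fun y => mcross (c y) (e y)) t
    (vadd (mcross dc (e t)) (mcross (c t) de)).
Proof.
  intros (h1 & h2 & h3) (k1 & k2 & k3).
  assert (aux : forall f1 f2 f3 f4 d1 d2 d3 d4 l,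
    is_derive f1 t d1 -> is_derive f2 t d2 ->
    is_derive f3 t d3 -> is_derive f4 t d4 ->
    l = d1 * f2 t + f1 t * d2 - (d3 * f4 t + f3 t * d4) ->
    is_derive (fun y => f1 y * f2 y - f3 y * f4 y) t l).
  { intros f1 f2 f3 f4 d1 d2 d3 d4 l i1 i2 i3 i4 ->.
    apply is_derive_minus_R; now apply is_derive_mult_R. }
  split; [| split]; simpl; eapply aux; eauto; ring.
Qed.

(** The norm is differentiable at a time-like vector because its square is
    away from [0], the only singularity of [Rabs] and [sqrt]. *)
Lemma ex_vderive_normalized (c : R -> vec3) (t : R) (dc : vec3) :
  time_like (c t) -> is_vderive c t dc ->
  exists l, is_vderive (fun y => vscale (/ mnorm (c y)) (c y)) t l.
Proof.
  intros hc h.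
  pose proof (is_derive_mdot c c t dc dc h h) as hm.
  apply (is_derive_Rabs _ _ _) in hm; [| unfold time_like in hc; lra].
  assert (ha : 0 < Rabs (mdot (c t) (c t))).
  { apply Rabs_pos_lt; unfold time_like in hc; lra. }
  apply (is_derive_sqrt _ _ _) in hm; [| exact ha].
  apply (is_derive_inv _ _ _) in hm;
    [| apply Rgt_not_eq, sqrt_lt_R0, ha].
  eexists; exact (is_vderive_scale _ _ _ _ _ hm h).
Qed.

Lemma interval_has_nearby_points (I : R -> Prop) (t delta : R) :
  is_interval I -> I t -> 0 < delta ->
  exists y, I y /\ y <> t /\ Rabs (y - t) < delta.
Proof.
  intros [(a & b & ha & hb & hab) hconv] ht hd.
  destruct (Rlt_le_dec t b) as [h | h].
  - exists (Rmin b (t + delta / 2)).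
    assert (hy : t < Rmin b (t + delta / 2) <= b).
    { split; [apply Rmin_glb_lt; lra | apply Rmin_l]. }
    pose proof (Rmin_r b (t + delta / 2)).
    split; [apply (hconv t b); auto; lra | split; [lra |]].
    rewrite Rabs_right; lra.
  - exists (Rmax a (t - delta / 2)).
    assert (hy : a <= Rmax a (t - delta / 2) < t).
    { split; [apply Rmax_l | apply Rmax_lub_lt; lra]. }
    pose proof (Rmax_r a (t - delta / 2)).
    split; [apply (hconv a t); auto; lra | split; [lra |]].
    rewrite Rabs_left; lra.
Qed.

(** Every point of the interval, an endpoint included, is a limit of other
    points of the interval, along which the difference quotients agree. *)
Lemma is_derive_eq_on (I : R -> Prop) (f h : R -> R) (t df dh : R) :
  is_interval I -> I t -> (forall y, I y -> f y = h y) ->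
  is_derive f t df -> is_derive h t dh -> df = dh.
Proof.
  intros hI ht heq hf hh.
  destruct (Req_dec df dh) as [e | ne]; [exact e | exfalso].
  assert (hk : is_derive (fun y => f y - h y) t (df - dh))
    by now apply is_derive_minus_R.
  apply is_derive_Reals in hk.
  assert (hpos : 0 < Rabs (df - dh)) by (apply Rabs_pos_lt; lra).
  destruct (hk _ hpos) as [delta hdelta].
  destruct (interval_has_nearby_points I t delta hI ht (cond_pos delta))
    as (y & hy & hne & hlt).
  specialize (hdelta (y - t) ltac:(lra) hlt).
  replace (t + (y - t)) with y in hdelta by ring.
  rewrite (heq y hy), (heq t ht) in hdelta.
  replace ((h y - h y - (h t - h t)) / (y - t) - (df - dh)) with (- (df - dh))
    in hdelta by (field; lra).
  rewrite Rabs_Ropp in hdelta; lra.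
Qed.

Lemma is_derive_const_on (I : R -> Prop) (f : R -> R) (t k df : R) :
  is_interval I -> I t -> (forall y, I y -> f y = k) ->
  is_derive f t df -> df = 0.
Proof.
  intros hI ht hk hf.
  apply (is_derive_eq_on I f (fun _ => k) t); auto.
  apply (is_derive_const (K := R_AbsRing) (V := R_NormedModule)).
Qed.

Lemma is_vderive_eq_on (I : R -> Prop) (c e : R -> vec3) (t : R) (dc de : vec3) :
  is_interval I -> I t -> (forall y, I y -> c y = e y) ->
  is_vderive c t dc -> is_vderive e t de -> dc = de.
Proof.
  intros hI ht heq (h1 & h2 & h3) (k1 & k2 & k3).
  apply vec3_eq;
    [ apply (is_derive_eq_on I (fun y => x1 (c y)) (fun y => x1 (e y)) t)
    | apply (is_derive_eq_on I (fun y => x2 (c y)) (fun y => x2 (e y)) t)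
    | apply (is_derive_eq_on I (fun y => x3 (c y)) (fun y => x3 (e y)) t) ];
    auto; intros y hy; now rewrite (heq y hy).
Qed.

Lemma constant_on_interval (I : R -> Prop) (f : R -> R) :
  is_interval I -> (forall t, I t -> is_derive f t 0) ->
  forall s t, I s -> I t -> f s = f t.
Proof.
  intros [_ hconv] h.
  assert (lt : forall s t, I s -> I t -> s < t -> f s = f t).
  { intros s t hs ht hst.
    apply (eq_is_derive f s t); [| exact hst].
    intros y hy; apply h, (hconv s t); auto. }
  intros s t hs ht.
  destruct (Rtotal_order s t) as [hlt | [-> | hlt]]; auto.
  symmetry; auto.
Qed.

Lemma smooth_on_vderive (I : R -> Prop) (c : R -> vec3) (t : R) :
  smooth_on I c -> I t ->
  locally t (fun s => is_vderive c s (vderive c s) /\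
                      is_vderive (vderive c) s (vderive (vderive c) s)).
Proof.
  intros h ht; generalize (h t ht); apply filter_imp; intros s hs.
  destruct (hs 1%nat) as (a1 & a2 & a3); destruct (hs 2%nat) as (b1 & b2 & b3).
  split; (split; [| split]); apply Derive_correct; assumption.
Qed.

(** Near an endpoint [t] the upper limit of integration leaves the interval, so
    integrability is needed slightly beyond it; this is why differentiability
    is asked on a neighbourhood of each point. *)
Lemma is_vderive_vint (I : R -> Prop) (c : R -> vec3) (t0 t : R) :
  is_interval I -> I t0 -> I t ->
  (forall s, I s -> locally s (fun y => exists l, is_vderive c y l)) ->
  is_vderive (vint c t0) t (c t).
Proof.
  intros [_ hconv] ht0 ht h.
  assert (key : forall f : R -> R,
    (forall s, I s -> locally s (fun y => continuous f y)) ->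
    is_derive (fun y => RInt f t0 y) t (f t)).
  { intros f hf.
    apply is_derive_RInt with t0.
    - destruct (hf t ht) as [eps heps].
      exists eps; intros y hy.
      apply (RInt_correct f), ex_RInt_continuous; intros z hz.
      change (Rabs (y - t) < eps) in hy; apply Rabs_def2 in hy.
      (* [z] is between [t0] and [t], or else between [t] and the nearby [y] *)
      assert (split : Rmin t0 t <= z <= Rmax t0 t \/ Rabs (z - t) < eps).
      { destruct (Rle_lt_dec (Rmin t0 t) z) as [p | p];
        [destruct (Rle_lt_dec z (Rmax t0 t)) as [q | q] |].
        - left; lra.
        - right; apply Rabs_def1; revert hz p q;
          unfold Rmin, Rmax; repeat destruct Rle_dec; lra.
        - right; apply Rabs_def1; revert hz p;
          unfold Rmin, Rmax; repeat destruct Rle_dec; lra. }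
      destruct split as [p | p].
      + apply locally_singleton, hf.
        revert p; unfold Rmin, Rmax; destruct Rle_dec; intro p;
          [apply (hconv t0 t) | apply (hconv t t0)]; auto.
      + now apply heps.
    - apply locally_singleton, hf, ht. }
  split; [| split]; simpl; apply key; intros s hs; generalize (h s hs);
    apply filter_imp; intros y (l & h1 & h2 & h3);
    apply (ex_derive_continuous (V := R_NormedModule)); eexists; eassumption.
Qed.

(** * The moving frame of a unit speed curve on the hyperbolic plane *)

Section HyperbolicCurve.

Variables (I : R -> Prop) (g : R -> vec3).
Hypotheses (hI : is_interval I) (hI0 : I 0).
Hypotheses (hg : unit_speed_space_like I g).
Hypothesis (hgH : forall t, I t -> in_H2 (g t)).

Let g' := vderive g.
Let g'' := vderive g'.
Let s (t : R) : vec3 := mcross (g t) (g' t).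

Lemma speed_sqr (t : R) : I t -> mdot (g' t) (g' t) = 1.
Proof.
  intro ht; destruct hg as [_ h]; destruct (h t ht).
  now apply space_like_unit.
Qed.

Lemma is_vderive_g (t : R) : I t -> is_vderive g t (g' t).
Proof.
  intro ht; destruct hg as [h _].
  exact (proj1 (locally_singleton _ _ (smooth_on_vderive I g t h ht))).
Qed.

Lemma is_vderive_g' (t : R) : I t -> is_vderive g' t (g'' t).
Proof.
  intro ht; destruct hg as [h _].
  exact (proj2 (locally_singleton _ _ (smooth_on_vderive I g t h ht))).
Qed.

Lemma velocity_tangent (t : R) : I t -> mdot (g t) (g' t) = 0.
Proof.
  intro ht.
  pose proof (is_derive_mdot g g t _ _ (is_vderive_g t ht) (is_vderive_g t ht))
    as h.
  apply (is_derive_const_on I _ t (-1)) in h; auto.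
  rewrite (mdot_comm (g' t)) in h; lra.
Qed.

Lemma acceleration_orthogonal (t : R) : I t -> mdot (g'' t) (g' t) = 0.
Proof.
  intro ht.
  pose proof (is_derive_mdot g' g' t _ _ (is_vderive_g' t ht)
    (is_vderive_g' t ht)) as h.
  apply (is_derive_const_on I _ t 1) in h; auto using speed_sqr.
  rewrite (mdot_comm (g' t)) in h; lra.
Qed.

(** Both [g] and its acceleration are orthogonal to the velocity, so the
    derivative of the third frame vector is a multiple of the velocity; the
    factor is minus the geodesic curvature. *)
Lemma is_vderive_s (t : R) :
  I t -> is_vderive s t (vscale (mdot (mcross (g t) (g'' t)) (g' t)) (g' t)).
Proof.
  intro ht.
  rewrite <- mcross_of_orthogonal;
    auto using velocity_tangent, acceleration_orthogonal, speed_sqr.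
  replace (mcross (g t) (g'' t))
    with (vadd (mcross (g' t) (g' t)) (mcross (g t) (g'' t)))
    by (apply vec3_eq; unfold vadd, mcross; simpl; ring).
  apply is_vderive_mcross; auto using is_vderive_g, is_vderive_g'.
Qed.

Lemma is_vderive_frame_combination (b t : R) :
  I t -> exists mu,
    is_vderive (fun y => vadd (g y) (vscale b (s y))) t (vscale mu (g' t)).
Proof.
  intro ht.
  set (lambda := mdot (mcross (g t) (g'' t)) (g' t)).
  exists (1 + b * lambda).
  replace (vscale _ (g' t))
    with (vadd (g' t) (vscale b (vscale lambda (g' t))))
    by (apply vec3_eq; unfold vadd, vscale; simpl; ring).
  apply is_vderive_add; [now apply is_vderive_g |].
  now apply is_vderive_scale_const, is_vderive_s.
Qed.

Lemma mdot_frame_combination (b t : R) :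
  I t ->
  mdot (vadd (g t) (vscale b (s t))) (vadd (g t) (vscale b (s t))) = b * b - 1.
Proof.
  intro ht.
  rewrite mdot_add_self, !mdot_scale_r, mdot_scale_l.
  unfold s; rewrite mdot_cross_l, mdot_cross_self.
  rewrite (hgH t ht), velocity_tangent, speed_sqr by exact ht; ring.
Qed.

(** * The associated Bertrand curve *)

Variables (a xi : R).

Let gamma := bertrand_curve g a xi.
Let W (y : R) : vec3 := vadd (g y) (vscale (tanh xi) (s y)).

Lemma vderive_bertrand (t : R) : I t -> vderive gamma t = vscale a (W t).
Proof.
  intro ht; destruct hg as [hs _].
  assert (e : vscale a (W t)
    = vadd (vscale a (g t)) (vscale (a * tanh xi) (s t)))
    by (apply vec3_eq; unfold W, vadd, vscale; simpl; ring).
  rewrite e; apply is_vderive_unique, is_vderive_add;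
    apply is_vderive_scale_const, (is_vderive_vint I); auto;
    intros r hr; generalize (smooth_on_vderive I g r hs hr);
    apply filter_imp; intros y (h1 & h2); eexists; [exact h1 |].
  exact (is_vderive_mcross _ _ _ _ _ h1 h2).
Qed.

Hypothesis (hgamma : time_like_curve I gamma).

Lemma tangent_in_H2 (t : R) : I t -> in_H2 (tangent gamma t).
Proof. intro ht; apply normalized_in_H2, hgamma, ht. Qed.

(** The speed of [gamma] is constant, since it depends only on the frame. *)
Lemma tangent_bertrand :
  exists k, k <> 0 /\ forall t, I t -> tangent gamma t = vscale k (W t).
Proof.
  assert (sq : forall t, I t -> mdot (vderive gamma t) (vderive gamma t)
    = a * a * (tanh xi * tanh xi - 1)).
  { intros t ht; rewrite vderive_bertrand, mdot_scale_l, mdot_scale_r by exact ht.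
    unfold W; rewrite mdot_frame_combination by exact ht; ring. }
  set (m := mnorm (vderive gamma 0)).
  assert (hm : 0 < m) by (apply mnorm_time_like_pos, hgamma, hI0).
  assert (ha : a <> 0).
  { intro e; pose proof (proj2 hgamma 0 hI0) as h; unfold time_like in h.
    rewrite sq, e in h by exact hI0; lra. }
  exists (/ m * a); split.
  { apply Rmult_integral_contrapositive_currified; [| exact ha].
    apply Rinv_neq_0_compat; lra. }
  intros t ht; unfold tangent, arc_derive.
  replace (mnorm (vderive gamma t)) with m
    by (unfold m, mnorm; now rewrite !sq).
  rewrite vderive_bertrand by exact ht.
  apply vec3_eq; unfold vscale; simpl; ring.
Qed.

(** Non-vanishing curvature says exactly that the factor is not zero.  The
    tangent is known only on [I], but its derivative there is determined by
    its values on [I]. *)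
Lemma is_vderive_W_nonzero (t : R) :
  I t -> curvature gamma t <> 0 ->
  exists mu, mu <> 0 /\ is_vderive W t (vscale mu (g' t)).
Proof.
  intros ht hcurv.
  destruct (is_vderive_frame_combination (tanh xi) t ht) as (mu & hmu).
  exists mu; split; [| exact hmu].
  intro e; apply hcurv.
  destruct tangent_bertrand as (k & _ & hk).
  destruct (ex_vderive_normalized (vderive gamma) t (vderive (vderive gamma) t))
    as (l & hl).
  { now apply hgamma. }
  { exact (proj2 (locally_singleton _ _
      (smooth_on_vderive I gamma t (proj1 hgamma) ht))). }
  assert (el : l = vscale k (vscale mu (g' t))).
  { apply (is_vderive_eq_on I (tangent gamma) (fun y => vscale k (W y)) t); auto.
    now apply is_vderive_scale_const. }
  unfold curvature, arc_derive at 1.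
  rewrite (is_vderive_unique (tangent gamma) t l hl), el, e.
  unfold mnorm; rewrite !mdot_scale_l.
  replace (/ _ * _) with 0 by ring.
  now rewrite Rabs_R0, sqrt_0.
Qed.

(** The derivatives of the two products are nonzero multiples of each other:
    [g] and the tangent of [gamma] have parallel derivatives. *)
Lemma mdot_g_constant_iff (d : vec3) :
  (forall t, I t -> curvature gamma t <> 0) ->
  (exists r, forall t, I t -> mdot (g t) d = r) <->
  (exists c, forall t, I t -> mdot (tangent gamma t) d = c).
Proof.
  intro hcurv.
  destruct tangent_bertrand as (k & hk0 & hk).
  split.
  - intros (r & hr).
    exists (k * mdot (W 0) d); intros t ht.
    rewrite hk, mdot_scale_l by exact ht; f_equal.
    apply (constant_on_interval I (fun y => mdot (W y) d)); auto.
    intros y hy.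
    destruct (is_vderive_W_nonzero y hy (hcurv y hy)) as (mu & _ & hmu).
    apply (is_derive_mdot_const _ d) in hmu; rewrite mdot_scale_l in hmu.
    replace 0 with (mu * mdot (g' y) d); [exact hmu |].
    rewrite (is_derive_const_on I (fun z => mdot (g z) d) y r (mdot (g' y) d));
      auto using is_derive_mdot_const, is_vderive_g; ring.
  - intros (c & hc).
    exists (mdot (g 0) d); intros t ht.
    apply (constant_on_interval I (fun y => mdot (g y) d)); auto.
    intros y hy.
    destruct (is_vderive_W_nonzero y hy (hcurv y hy)) as (mu & hmu0 & hmu).
    apply (is_derive_mdot_const _ d) in hmu; rewrite mdot_scale_l in hmu.
    apply (is_derive_const_on I _ y (/ k * c)) in hmu; auto.
    + replace 0 with (mdot (g' y) d);
        [auto using is_derive_mdot_const, is_vderive_g |].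
      apply Rmult_integral in hmu; tauto.
    + intros z hz; rewrite <- (hc z hz), hk, mdot_scale_l by exact hz.
      now field.
Qed.

End HyperbolicCurve.

Theorem corollary2 (I : R -> Prop) (g : R -> vec3) (a theta u : R)
  (hI : is_interval I) (hI0 : I 0)
  (hg : unit_speed_space_like I g)
  (hgH : forall t, I t -> in_H2 (g t))
  (htheta : theta <> 0) (hu : 0 < u)
  (hB : time_like_Bertrand I (bertrand_curve g a (xi2 theta u))) :
  part_of_pseudo_circle I g <->
  time_like_helix I (bertrand_curve g a (xi2 theta u)).
Proof.
  destruct hB as (hgamma & hcurv & _).
  pose proof (mdot_g_constant_iff I g hI hI0 hg hgH a (xi2 theta u) hgamma)
    as core.
  pose proof (constant_hyperbolic_angle I
    (tangent (bertrand_curve g a (xi2 theta u))) 0 hI0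
    (tangent_in_H2 I g a (xi2 theta u) hgamma)) as angle.
  split.
  - intros (u0 & r & hu0 & hr).
    split; [exact hgamma |].
    apply angle.
    destruct (proj1 (core u0 hcurv)) as (c & hc); [| now exists u0, c].
    exists r; intros t ht; apply (hr t ht).
  - intros (_ & h).
    apply angle in h; destruct h as (u0 & c & hu0 & hc).
    destruct (proj2 (core u0 hcurv)) as (r & hr); [now exists c |].
    exists u0, r; split; [exact hu0 |].
    intros t ht; split; auto.
Qed.
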